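(* Let $R$ be an associative ring with unity $1$ and let $a,b,c,v,w\in R$. Then the following statements are equivalent: (i) $a$ has a $(v,w)$-weighted $(b,c)$-inverse. (ii) $b$ is regular, $R=Rcvaw\oplus lann(b)$, and $lann(vaw)\cap Rc=\{0\}$. (iii) $R=Rcvaw\oplus lann(b)$, $lann(vaw)\cap Rc=\{0\}$, and $cvawb$ is regular. (iv) $c$ is regular, $R=vawbR\oplus rann(c)$, and $rann(vaw)\cap bR=\{0\}$. (v) $R=vawbR\oplus rann(c)$, $rann(vaw)\cap bR=\{0\}$, and $cvawb$ is regular.
   Context: For $x$ in an associative ring $R$ with unity: $xR=\{xr: r\in R\}$, $Rx=\{rx: r\in R\}$, $lann(x)=\{z\in R: zx=0\}$, $rann(x)=\{z\in R: xz=0\}$. $R=A\oplus B$ means $R=A+B$ and $A\cap B=\{0\}$. An element $x\in R$ is regular if there is $u\in R$ with $xux=x$. An element $y\in R$ is a $(v,w)$-weighted $(b,c)$-inverse of $a$ if $y\in bRwy\cap yvRc$, $yvawb=b$ and $cvawy=c$ (here $bRwy=\{brwy: r\in R\}$ and $yvRc=\{yvrc: r\in R\}$). *)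

(* Defs.v *)
From mathcomp Require Import all_boot all_algebra.
From mathcomp Require Import classical_sets.

Set Implicit Arguments.
Unset Strict Implicit.
Unset Printing Implicit Defensive.

Import GRing.Theory.
Local Open Scope ring_scope.
Local Open Scope classical_set_scope.

Definition right_mult (R : pzRingType) (x : R) : set R :=
  [set x * r | r in [set: R]].

Definition left_mult (R : pzRingType) (x : R) : set R :=
  [set r * x | r in [set: R]].

Definition lann (R : pzRingType) (x : R) : set R := [set z | z * x = 0].

Definition rann (R : pzRingType) (x : R) : set R := [set z | x * z = 0].

Definition set_sum (R : pzRingType) (A B : set R) : set R :=
  [set p + q | p in A & q in B].

Definition ring_direct_sum (R : pzRingType) (A B : set R) : Prop :=
  [set: R] = set_sum A B /\ A `&` B = [set 0].

(* von Neumann regularity; unrelated to the cancellability notions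
   [GRing.lreg] and [GRing.rreg]. *)
Definition vn_regular (R : pzRingType) (x : R) : Prop :=
  exists u : R, x * u * x = x.

Definition is_weighted_bc_inverse (R : pzRingType) (v w b c a y : R) : Prop :=
  [/\ ([set b * r * w * y | r in [set: R]] `&`
       [set y * v * r * c | r in [set: R]]) y,
      y * v * a * w * b = b
    & c * v * a * w * y = c].

(* Main.v *)
(* With m = vaw, every condition is equivalent to the existence of g with
   b g (c m b) = b and (c m b) g c = c; then y = b g c is the weighted inverse,
   and g is an inner inverse of c m b. The conditions on right ideals are those
   on left ideals read in the converse ring with b and c exchanged. *)
Require Import Defs.
From mathcomp Require Import all_boot all_algebra.
From mathcomp Require Import classical_sets.

Set Implicit Arguments.
Unset Strict Implicit.
Unset Printing Implicit Defensive.

Import GRing.Theory.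
Local Open Scope ring_scope.
Local Open Scope classical_set_scope.

Definition sandwich_inverse (R : pzRingType) (b c m g : R) : Prop :=
  b * g * (c * m * b) = b /\ c * m * b * g * c = c.

(** Split 1 as [t * x + l] with [l * b = 0] and multiply by [b] on the right. *)
Lemma left_sum_factor (R : pzRingType) (b x : R) :
  ring_direct_sum (left_mult x) (lann b) -> exists t, t * x * b = b.
Proof.
move=> [sumR _]; have : [set: R] 1 by [].
rewrite sumR => -[_ [t _ <-] [l lb0 txl1]]; exists t.
by rewrite -[RHS]mul1r -txl1 mulrDl lb0 addr0.
Qed.

(** If [t * x * b = b] and [b * u * b = b], then [u * t] is an inner inverse of [x * b]. *)
Lemma left_regular_mul (R : pzRingType) (b x : R) :
  ring_direct_sum (left_mult x) (lann b) ->
  vn_regular b -> vn_regular (x * b).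
Proof.
move=> /left_sum_factor[t txb] [u bub]; exists (u * t).
by rewrite -mulrA -(mulrA u) (mulrA t) txb -mulrA (mulrA b) bub.
Qed.

Lemma sandwich_inverse_left (R : pzRingType) (b c m : R) :
  (exists g, sandwich_inverse b c m g) <->
  [/\ ring_direct_sum (left_mult (c * m)) (lann b),
      lann m `&` left_mult c = [set 0]
    & vn_regular (c * m * b)].
Proof.
split=> [[g [bgb cgc]] | [dsum capm0 [g gP]]].
  (* Multiplying by [g * c] on the right turns [k * c * m * b] into [k * c]; both trivial
     intersections follow from this. *)
  have zero k : k * (c * m) * b = 0 -> k * c = 0.
    by move=> k0; rewrite -cgc !mulrA -(mulrA k) k0 !mul0r.
  split.
  - split; apply/seteqP; (split=> [x|z]; last first); [by [] | move=> _ | move=> -> | ].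
    (* The remainder [x - x * b * g * c * m] annihilates [b] because [b * g * (c * m * b) = b]. *)
    + exists (x * (b * g) * (c * m)); first by exists (x * (b * g)).
      exists (x - x * (b * g) * (c * m)); last by rewrite addrC subrK.
      by rewrite /lann /= mulrBl -!mulrA !(mulrA c) (mulrA b) bgb subrr.
    + by split; [exists 0; rewrite ?mul0r | rewrite /lann /= mul0r].
    + by move=> [[k _ <-] /zero kc0]; rewrite /= mulrA kc0 mul0r.
  - apply/seteqP; split=> [z [/= zm0 [k _ kcz]] | z ->].
      by rewrite /= -kcz zero // mulrA kcz zm0 mul0r.
    by split; [rewrite /lann /= mul0r | exists 0; rewrite ?mul0r].
  - by exists g; rewrite -!mulrA !(mulrA c) (mulrA b) bgb.
have [t tP] := left_sum_factor dsum; exists g; split.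
  (* Left multiplication by [t] cancels [c * m] in front of [b], so the inner inverse identity for
     [c * m * b] becomes the first equation. *)
  transitivity (t * (c * m * b * g * (c * m * b))).
    by rewrite -{1}tP !mulrA.
  by rewrite gP -[RHS]tP !mulrA.
(* The two intersections are used in turn: [d * m] lies in [R c m] and annihilates [b], hence
   vanishes; then [d] lies in [R c] and annihilates [m], hence vanishes. *)
apply/subr0_eq; set d := _ - c.
have dE : d = (c * m * b * g - 1) * c by rewrite mulrBl mul1r.
have dm0 : d * m = 0.
  have [_ cap0] := dsum.
  suff : [set 0] (d * m) by [].
  rewrite -cap0; split; first by exists (c * m * b * g - 1); rewrite // dE mulrA.
  by rewrite /lann /= dE !mulrBl !mul1r -[X in _ - X]gP !mulrA subrr.
suff : [set 0] d by [].
by rewrite -capm0; split=> //; exists (c * m * b * g - 1).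
Qed.

Lemma vn_regular_converse (R : pzRingType) (x : R) :
  vn_regular (x : R^c) <-> vn_regular x.
Proof.
split=> -[u xux]; exists u; last exact: etrans (@mulrA R x u x) xux.
exact: etrans (esym (@mulrA R x u x)) xux.
Qed.

Lemma sandwich_inverse_converse (R : pzRingType) (b c m g : R) :
  sandwich_inverse (c : R^c) b m g <-> sandwich_inverse b c m g.
Proof.
(* Products in [R^c] are convertible to reversed products in [R], so only the bracketing and the
   order of the two equations differ. *)
have -> : sandwich_inverse (c : R^c) b m g =
    (c * (m * b) * (g * c) = c /\ b * (g * (c * (m * b))) = b) by [].
by rewrite /sandwich_inverse !mulrA; split=> -[].
Qed.

Lemma right_regular_mul (R : pzRingType) (c x : R) :
  ring_direct_sum (right_mult x) (rann c) ->
  vn_regular c -> vn_regular (c * x).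
Proof.
move=> dsum /vn_regular_converse creg; apply/vn_regular_converse.
exact: (@left_regular_mul R^c).
Qed.

Lemma sandwich_inverse_right (R : pzRingType) (b c m : R) :
  (exists g, sandwich_inverse b c m g) <->
  [/\ ring_direct_sum (right_mult (m * b)) (rann c),
      rann m `&` right_mult b = [set 0]
    & vn_regular (c * m * b)].
Proof.
(* Over [R^c], [left_mult] and [lann] compute to [right_mult] and [rann], and [b * m * c] to
   [c * (m * b)], whence the reassociation below. *)
have convP := @sandwich_inverse_left R^c c b m.
rewrite -mulrA; split=> [[g /sandwich_inverse_converse gP] |].
  by have [] := convP.1 (ex_intro _ g gP) => ? ? /vn_regular_converse.
move=> [dsum cap0 /vn_regular_converse reg].
have [g /sandwich_inverse_converse gP] := convP.2 (And3 dsum cap0 reg).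
by exists g.
Qed.

Lemma weighted_bc_inverse_sandwich (R : pzRingType) (a b c v w : R) :
  (exists y, is_weighted_bc_inverse v w b c a y) <->
  exists g, sandwich_inverse b c (v * a * w) g.
Proof.
split=> [[y [[[r _ yl] [s _ yr]] yb cy]] | [g [bgb cgc]]].
  rewrite /= in yl yr.
  (* Expand the first [y] as [y * v * s * c] and absorb the rest by [c * v * a * w * y = c]. *)
  have ymy : y * (v * a * w) * y = y.
    by rewrite -{1}yr -[RHS]yr -[in RHS]cy !mulrA.
  (* Chosen so that [b * g * c] is [y * (v * a * w) * y] with its outer factors written as
     [b * r * w * y] and [y * v * s * c]. *)
  exists (r * w * y * (v * a * w) * (y * v * s)); set g := _ * (y * v * s).
  have bgc : b * g * c = y.
    transitivity (b * r * w * y * (v * a * w) * (y * v * s * c)).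
      by rewrite /g !mulrA.
    by rewrite yl yr ymy.
  split; first by rewrite -[RHS]yb -[in RHS]bgc !mulrA.
  transitivity (c * (v * a * w) * (b * g * c)); first by rewrite !mulrA.
  by rewrite bgc -[RHS]cy !mulrA.
exists (b * g * c); rewrite !mulrA in bgb cgc.
split; [split | by [] | by rewrite !mulrA].
  by exists (g * c * v * a); rewrite // !mulrA bgb.
by exists (a * w * b * g); rewrite // !mulrA bgb.
Qed.

Theorem theorem3p3 (R : pzRingType) (a b c v w : R) :
  [<-> exists y : R, is_weighted_bc_inverse v w b c a y;
       [/\ vn_regular b,
           ring_direct_sum (left_mult (c * v * a * w)) (lann b)
         & lann (v * a * w) `&` left_mult c = [set 0]];
       [/\ ring_direct_sum (left_mult (c * v * a * w)) (lann b),
           lann (v * a * w) `&` left_mult c = [set 0]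
         & vn_regular (c * v * a * w * b)];
       [/\ vn_regular c,
           ring_direct_sum (right_mult (v * a * w * b)) (rann c)
         & rann (v * a * w) `&` right_mult b = [set 0]];
       [/\ ring_direct_sum (right_mult (v * a * w * b)) (rann c),
           rann (v * a * w) `&` right_mult b = [set 0]
         & vn_regular (c * v * a * w * b)]].
Proof.
have -> : c * v * a * w = c * (v * a * w) by rewrite !mulrA.
tfae.
- move=> /weighted_bc_inverse_sandwich gP.
  have [dsum cap0 _] := (sandwich_inverse_left b c _).1 gP; split=> //.
  by case: gP => g [bgb _]; exists (g * (c * (v * a * w))); rewrite -[RHS]bgb !mulrA.
- by move=> [breg dsum cap0]; split=> //; exact: left_regular_mul.
(* The passage from left to right ideals goes through [g], whose second equation also makes
   [v * a * w * b * g] an inner inverse of [c]. *)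
- move=> /sandwich_inverse_left gP.
  have [dsum cap0 _] := (sandwich_inverse_right b c _).1 gP; split=> //.
  by case: gP => g [_ cgc]; exists (v * a * w * b * g); rewrite -[RHS]cgc !mulrA.
- move=> [creg dsum cap0]; split=> //.
  by rewrite -mulrA; exact: right_regular_mul.
- by move=> /sandwich_inverse_right /weighted_bc_inverse_sandwich.
Qed.
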